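(* Let $\underline{Q}$ be a lower transition rate operator on $\mathcal{L}(\mathcal{X})$, $f\in\mathcal{L}(\mathcal{X})$, $t\in\mathbb{R}_{\geq0}$, $\epsilon\in\mathbb{R}_{>0}$ and $m\in\mathbb{N}$, and let $n$, $k$, and (if applicable) $k_i$, $\delta_i$, $g_{(i,j)}$ be determined by the adaptive procedure described in the context. If $\|f\|_c=0$, $\|\underline{Q}\|=0$ or $t=0$, then $\|\underline{T}_tf-g_{(n,k)}\|=0$. Otherwise, $$\|\underline{T}_tf-\Phi_{m,k}(\delta_1,\dots,\delta_n)f\|=\|\underline{T}_tf-g_{(n,k)}\|\leq\epsilon':=\sum_{i=1}^n\delta_i^2\|\underline{Q}\|^2\sum_{j=0}^{k_i-1}\|g_{(i,j)}\|_c\leq\epsilon,$$ and the total number of iterations satisfies $$\sum_{i=1}^nk_i=(n-1)m+k\leq\left\lceil\max\left\{\frac{\|\underline{Q}\|t}{2},\ \frac{t^2\|\underline{Q}\|^2\|f\|_c}{\epsilon}\right\}\right\rceil.$$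
   Context: $\mathcal{X}$ is a non-empty finite set and $\mathcal{L}(\mathcal{X})$ is the vector space of real-valued functions on $\mathcal{X}$; real numbers are identified with constant functions and inequalities between functions are pointwise. $\|f\|:=\max_{x}|f(x)|$, $\|f\|_v:=\max f-\min f$, $\|f\|_c:=\|f\|_v/2$. $\mathbb{I}_x$ is the indicator function of $\{x\}$, and $I$ is the identity operator. The norm of a non-negatively homogeneous operator $A$ on $\mathcal{L}(\mathcal{X})$ (i.e. $A(\mu f)=\mu Af$ for $\mu\ge0$) is $\|A\|:=\sup\{\|Af\|: \|f\|=1\}$. $\mathbb{N}=\{1,2,\dots\}$. A lower transition rate operator is a map $\underline{Q}:\mathcal{L}(\mathcal{X})\to\mathcal{L}(\mathcal{X})$ such that for all $f,g\in\mathcal{L}(\mathcal{X})$, $\mu\geq 0$, $\gamma\in\mathbb{R}$ and $x\neq y$ in $\mathcal{X}$: $\underline{Q}\gamma=0$; $\underline{Q}(f+g)\geq\underline{Q}f+\underline{Q}g$; $\underline{Q}(\mu f)=\mu\underline{Q}f$; $[\underline{Q}\mathbb{I}_x](y)\geq 0$. For such $\underline{Q}$ and $f\in\mathcal{L}(\mathcal{X})$, $t\mapsto\underline{T}_tf$ denotes the unique solution on $\mathbb{R}_{\ge0}$ of $\frac{\mathrm d}{\mathrm dt}\underline{T}_tf=\underline{Q}\,\underline{T}_tf$ with $\underline{T}_0f=f$ (existence and uniqueness are known). For $n\ge1$ and $1\le k\le m$, $\Phi_{m,k}(\delta_1,\dots,\delta_n):=(I+\delta_n\underline{Q})^k(I+\delta_{n-1}\underline{Q})^m\cdots(I+\delta_1\underline{Q})^m$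 (for $n=1$ this is $(I+\delta_1\underline{Q})^k$). Adaptive procedure. Set $g_{(0,m)}:=f$. If $\|f\|_c=0$ or $\|\underline{Q}\|=0$ or $t=0$, put $n:=0$, $k:=m$ (so $g_{(n,k)}=f$) and stop. Otherwise start with $\Delta:=t$ and $i:=0$, and while $\Delta>0$ and $\|g_{(i,m)}\|_c>0$ do the following: (1) increase $i$ by $1$; (2) put $\delta_i:=\min\{\Delta,\ 2/\|\underline{Q}\|,\ \epsilon/(t\|\underline{Q}\|^2\|g_{(i-1,m)}\|_c)\}$; (3) if $m\delta_i>\Delta$, put $k_i:=\lceil\Delta/\delta_i\rceil$ and then redefine $\delta_i:=\Delta/k_i$; else put $k_i:=m$; (4) put $g_{(i,0)}:=g_{(i-1,m)}$ and replace $\Delta$ by $\Delta-k_i\delta_i$; (5) for $j=0,\dots,k_i-1$ put $g_{(i,j+1)}:=g_{(i,j)}+\delta_i\underline{Q}g_{(i,j)}$. (If $m\delta_i>\Delta$ occurs in step (3), then $\Delta=0$ after step (4) and the loop ends.) When the loop ends, put $n:=i$ and $k:=k_n$. In these formulas, $\delta_i$ in the theorem denotes the final value of $\delta_i$ after step (3). *)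

(* Defs.v *)
From HB Require Import structures.
From mathcomp Require Export all_boot all_order all_algebra.
From mathcomp Require Export all_classical all_reals all_analysis.

Set Implicit Arguments.
Unset Strict Implicit.
Unset Printing Implicit Defensive.

Import Order.TTheory GRing.Theory Num.Theory numFieldNormedType.Exports.

Local Open Scope classical_set_scope.
Local Open Scope ring_scope.

Section Operators.
Context {R : realType} {X : finType}.
Local Notation L := {ffun X -> R}.

Definition fnorm (f : L) : R := \big[Num.max/0]_(x : X) `|f x|.

(* [X] being finite and non-empty, these [sup] and [inf] are max f and min f *)
Definition vnorm (f : L) : R := sup (range f) - inf (range f).

Definition cnorm (f : L) : R := vnorm f / 2.

Definition opnorm (A : L -> L) : R := sup [set fnorm (A f) | f in [set f | fnorm f = 1]].

Definition const_fun (c : R) : L := [ffun=> c].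

Definition indic_fun (x : X) : L := [ffun y => (y == x)%:R].

Record lower_rate_operator (Q : L -> L) : Prop := LowerRateOperator {
  lro_const : forall c : R, Q (const_fun c) = 0;
  lro_superadd : forall (f g : L) (x : X), Q f x + Q g x <= Q (f + g) x;
  lro_homog : forall (mu : R) (f : L), 0 <= mu -> Q (mu *: f) = mu *: Q f;
  lro_offdiag : forall x y : X, x != y -> 0 <= Q (indic_fun x) y }.

(* [u' = Q u] on the half-line [0 <= s] with [u 0 = f]: the restriction
   [0 <= s + h] makes the derivative at 0 one-sided, and values of [u] at
   negative times play no role *)
Definition solves (Q : L -> L) (f : L) (u : R -> L) : Prop :=
  u 0 = f /\
  forall s : R, 0 <= s ->
    (fun h : R => fnorm (h^-1 *: (u (s + h) - u s) - Q (u s)))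
      @ within [set h | 0 <= s + h] (0 : R)^' --> (0 : R).

Definition lower_transition (Q : L -> L) (T : R -> L -> L) : Prop :=
  forall f : L, solves Q f (fun s => T s f).

Definition euler (Q : L -> L) (d : R) (g : L) : L := g + d *: Q g.

(* [Phi Q m k [:: d_1; ...; d_n]] applies the [d_1]-steps first; only the last
   step size is used [k] times instead of [m] *)
Fixpoint Phi (Q : L -> L) (m k : nat) (ds : seq R) (f : L) : L :=
  if ds is d :: ds' then
    Phi Q m k ds' (iter (if ds' is [::] then k else m) (euler Q d) f)
  else f.

End Operators.

Section Adaptive.
Context {R : realType} {X : finType}.
Local Notation L := {ffun X -> R}.
Variables (Q : L -> L) (f : L) (t eps : R) (m : nat).

(* One pass through the loop, as a function of the remaining time [D] and the
   current function [g]. *)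
Definition tentative_step (D : R) (g : L) : R :=
  Num.min D (Num.min (2 / opnorm Q) (eps / (t * opnorm Q ^+ 2 * cnorm g))).

Definition step_count (D : R) (g : L) : nat :=
  let d := tentative_step D g in
  if D < m%:R * d then `|Num.ceil (D / d)|%N else m.

Definition step_length (D : R) (g : L) : R :=
  let d := tentative_step D g in
  if D < m%:R * d then D / (step_count D g)%:R else d.

(* The remaining time and g_(i,m) after [i] passes. For uniformity, the loop is
   continued past its end, and in a pass with fewer than [m] steps g_(i,j) is
   also defined for j up to [m]; [adaptive_output] disregards these values, as
   the remaining time is 0 after such a pass. *)
Fixpoint adaptive_state (i : nat) : R * L :=
  if i is i'.+1 then
    let: (D, g) := adaptive_state i' in
    (D - (step_count D g)%:R * step_length D g,
     iter m (euler Q (step_length D g)) g)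
  else (t, f).

(* k_i and delta_i (final value), meaningful for [0 < i] *)
Definition adaptive_k (i : nat) : nat :=
  let: (D, g) := adaptive_state i.-1 in step_count D g.

Definition adaptive_delta (i : nat) : R :=
  let: (D, g) := adaptive_state i.-1 in step_length D g.

Definition adaptive_g (i j : nat) : L :=
  if i is i'.+1 then iter j (euler Q (adaptive_delta i)) (adaptive_state i').2
  else f.

Definition adaptive_trivial : Prop :=
  [\/ cnorm f = 0, opnorm Q = 0 | t = 0].

Definition adaptive_continues (i : nat) : Prop :=
  0 < (adaptive_state i).1 /\ 0 < cnorm (adaptive_g i m).

(* The procedure stops, with the values [n] and [k]. *)
Definition adaptive_output (n k : nat) : Prop :=
  (adaptive_trivial /\ n = 0%N /\ k = m) \/
  (~ adaptive_trivial /\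
   (forall i, (i < n)%N -> adaptive_continues i) /\
   ~ adaptive_continues n /\
   k = adaptive_k n).

End Adaptive.

(* Main.v *)
(** The operator [I + hQ] is non-expansive as soon as [h ||Q|| <= 2]. Hence, for a
    solution [u] of [u' = Qu] and the straight line [v r = g + rQg], the distance
    [||u (s + r) - v r||] grows at a rate at most
    [||Qg - Q (v r)|| <= r ||Q||^2 ||g||_c], which bounds the error added by one
    Euler step without using the semigroup property or uniqueness of solutions.
    The number of steps is controlled by [||g_(i,j)||_c] being non-increasing: every
    step outside the last pass of the loop has length at least
    [min (2 / ||Q||) (eps / (t ||Q||^2 ||f||_c))]. *)

Require Import Defs.
From mathcomp Require Import ring lra.

Import Order.TTheory GRing.Theory Num.Theory numFieldNormedType.Exports.

Local Open Scope classical_set_scope.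
Local Open Scope ring_scope.

(** * The maximum norm, the range and the centred seminorm of functions *)

Section Functions.
Context {R : realType} {X : finType}.
Local Notation L := {ffun X -> R}.
Implicit Types (f g : L) (a b c : R) (x y : X).

Lemma ffunDE f g x : (f + g) x = f x + g x.
Proof. by rewrite ffunE. Qed.

Lemma ffunNE f x : (- f) x = - f x.
Proof. by rewrite ffunE. Qed.

Lemma ffunZE a f x : (a *: f) x = a * f x.
Proof. by rewrite ffunE. Qed.

Lemma const_funE a x : (const_fun a : L) x = a.
Proof. by rewrite ffunE. Qed.

Definition pointE := (ffunDE, ffunNE, ffunZE, const_funE).

Lemma fnorm_leP f c : reflect (0 <= c /\ forall x, `|f x| <= c) (fnorm f <= c).
Proof.
by apply: (iffP (bigmax_leP _ _ _ _)) => -[c0 fc]; split => // x; apply: fc.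
Qed.

Lemma le_fnorm f x : `|f x| <= fnorm f.
Proof. exact: le_bigmax. Qed.

Lemma fnorm_ge0 f : 0 <= fnorm f.
Proof. by have /fnorm_leP[] := lexx (fnorm f). Qed.

Lemma fnorm0 : fnorm (0 : L) = 0.
Proof.
apply/eqP; rewrite eq_le fnorm_ge0 andbT; apply/fnorm_leP; split=> // x.
by rewrite ffunE normr0.
Qed.

Lemma fnorm_eq0 f : fnorm f = 0 -> f = 0.
Proof.
move=> f0; apply/ffunP => x; rewrite ffunE; apply/normr0_eq0/eqP.
by rewrite eq_le normr_ge0 andbT -f0 le_fnorm.
Qed.

Lemma fnormN f : fnorm (- f) = fnorm f.
Proof. by apply: eq_bigr => x _; rewrite ffunNE normrN. Qed.

Lemma fnormD f g : fnorm (f + g) <= fnorm f + fnorm g.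
Proof.
apply/fnorm_leP; split=> [|x]; first by rewrite addr_ge0 ?fnorm_ge0.
by rewrite ffunDE (le_trans (ler_normD _ _))// lerD ?le_fnorm.
Qed.

Lemma fnormZ a f : fnorm (a *: f) = `|a| * fnorm f.
Proof.
apply/eqP; rewrite eq_le; apply/andP; split.
  apply/fnorm_leP; split=> [|x]; first by rewrite mulr_ge0 ?fnorm_ge0.
  by rewrite ffunZE normrM ler_wpM2l ?le_fnorm.
have [->|a0] := eqVneq a 0; first by rewrite normr0 mul0r fnorm_ge0.
rewrite mulrC -ler_pdivlMr ?normr_gt0//; apply/fnorm_leP.
split=> [|x]; first by rewrite divr_ge0 ?fnorm_ge0.
by rewrite ler_pdivlMr ?normr_gt0// mulrC -normrM -ffunZE le_fnorm.
Qed.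

Lemma fnorm_bounds f x : - fnorm f <= f x <= fnorm f.
Proof. by rewrite -ler_norml le_fnorm. Qed.

Context (X0 : (0 < #|X|)%N).

Lemma range_nonempty f : range f !=set0.
Proof. by have /card_gt0P[x _] := X0; exists (f x), x. Qed.

Lemma sup_ge f x : f x <= sup (range f).
Proof.
apply: sup_upper_bound; last by exists x.
split; first exact: range_nonempty.
by exists (fnorm f) => _ [z _ <-]; have /andP[] := fnorm_bounds f z.
Qed.

Lemma inf_le f x : inf (range f) <= f x.
Proof.
apply: ge_inf; last by exists x.
by exists (- fnorm f) => _ [z _ <-]; have /andP[] := fnorm_bounds f z.
Qed.

Lemma cnorm_le f a b : (forall x, a <= f x <= b) -> cnorm f <= (b - a) / 2.
Proof.
move=> fab; rewrite /cnorm /vnorm ler_wpM2r// lerB//.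
  by apply: ge_sup; [exact: range_nonempty|move=> _ [x _ <-]; have /andP[] := fab x].
by apply: lb_le_inf; [exact: range_nonempty|move=> _ [x _ <-]; have /andP[] := fab x].
Qed.

Lemma cnorm_ge0 f : 0 <= cnorm f.
Proof.
have /card_gt0P[x _] := X0; rewrite divr_ge0// subr_ge0.
by rewrite (le_trans (inf_le f x))// sup_ge.
Qed.

(** The midpoint of the range is the constant nearest to [f]; subtracting it turns bounds by [fnorm]
    into bounds by [cnorm]. *)
Lemma cnorm_midpoint f : {c | fnorm (f - const_fun c) <= cnorm f}.
Proof.
exists ((sup (range f) + inf (range f)) / 2); apply/fnorm_leP.
split=> [|x]; first exact: cnorm_ge0.
have := sup_ge f x; have := inf_le f x.
rewrite !pointE ler_norml /cnorm /vnorm; lra.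
Qed.

End Functions.

(** * Lower transition rate operators, their norm and their Euler steps *)

Section RateOperators.
Context {R : realType} {X : finType}.
Context (X0 : (0 < #|X|)%N).
Local Notation L := {ffun X -> R}.
Context {Q : L -> L} (hQ : lower_rate_operator Q).
Implicit Types (f g : L) (a b c d : R) (x y : X).

Lemma rate0 : Q 0 = 0.
Proof. by rewrite -(scale0r (0 : L)) (lro_homog hQ)// !scale0r. Qed.

Lemma rateB_ge f g x : Q (f - g) x <= Q f x - Q g x.
Proof. by rewrite lerBrDr -[X in _ <= Q X _](subrK g); apply: (lro_superadd hQ). Qed.

Lemma rateB_le f g x : Q f x - Q g x <= - Q (g - f) x.
Proof. by have := rateB_ge g f x; lra. Qed.

(** Superadditivity against a constant, which [Q] sends to 0, gives one inequality; undoing the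
    shift gives the other. *)
Lemma rate_shift f c : Q (f - const_fun c) = Q f.
Proof.
have shift g b x : Q g x <= Q (g - const_fun b) x.
  have -> : - const_fun b = const_fun (- b) :> L.
    by apply/ffunP => z; rewrite !pointE.
  have := lro_superadd hQ g (const_fun (- b)) x.
  by rewrite (lro_const hQ) ffunE addr0.
apply/ffunP => x; apply/eqP; rewrite eq_le shift andbT.
have := shift (f - const_fun c) (- c) x.
have -> // : f - const_fun c - const_fun (- c) = f.
by apply/ffunP => z; rewrite !pointE; lra.
Qed.

Lemma ffun_indic_sum f : f = \sum_y f y *: indic_fun y.
Proof.
apply/ffunP => x; rewrite sum_ffunE (bigD1 x)//= big1 => [|y yx].
  by rewrite ffunZE ffunE eqxx mulr1 addr0.
by rewrite ffunZE ffunE eq_sym (negPf yx) mulr0.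
Qed.

Lemma rate_sum_ge (F : X -> L) x : \sum_y Q (F y) x <= Q (\sum_y F y) x.
Proof.
elim/big_rec2: _ => [|y a f _ IH]; first by rewrite rate0 ffunE.
by apply: le_trans (lro_superadd hQ _ _ _); rewrite lerD2l.
Qed.

Lemma rate_diag_ge f x : (forall y, 0 <= f y) -> f x * Q (indic_fun x) x <= Q f x.
Proof.
move=> f0; rewrite [X in _ <= Q X _]ffun_indic_sum.
apply: le_trans (rate_sum_ge _ _); rewrite (bigD1 x)//=.
rewrite (lro_homog hQ)// ffunZE lerDl sumr_ge0// => y yx.
by rewrite (lro_homog hQ)// ffunZE mulr_ge0// (lro_offdiag hQ).
Qed.

(** Makes the supremum in [opnorm] a genuine one, since [sup] of an unbounded set is a default
    value. *)
Lemma rate_fnorm_bounded :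
  has_ubound [set fnorm (Q f) | f in [set f | fnorm f = 1]].
Proof.
pose K := \big[Num.max/0]_x `|Q (indic_fun x) x|.
have Qge f x : fnorm f <= 1 -> - (2 * K) <= Q f x.
  move=> f1; have fx z := andP (fnorm_bounds f z).
  (* Adding 1 makes the function non-negative with values at most 2, hence the factor 2 in the
     bound. *)
  rewrite -(rate_shift f (-1)).
  have /(rate_diag_ge (f - const_fun (-1))) : forall z, 0 <= (f - const_fun (-1)) z.
    by move=> z; rewrite !pointE; have [] := fx z; lra.
  move=> /(_ x); apply: le_trans; rewrite !pointE.
  have : `|Q (indic_fun x) x| <= K by apply: le_bigmax.
  rewrite ler_norml => /andP[]; have [] := fx x; nra.
exists (2 * K) => _ [f /= f1 <-]; apply/fnorm_leP; split.
  by rewrite mulr_ge0//; apply: bigmax_ge_id.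
move=> x; rewrite ler_norml Qge ?f1//=.
have := Qge (- f) x; rewrite fnormN f1 => /(_ (lexx _)).
by have := rateB_le f 0 x; rewrite rate0 sub0r ffunE; lra.
Qed.

Lemma rate_fnorm_le f : fnorm (Q f) <= opnorm Q * fnorm f.
Proof.
have [f0|f0] := eqVneq (fnorm f) 0.
  by rewrite (fnorm_eq0 _ f0) rate0 fnorm0 mulr0.
have fp : 0 < fnorm f by rewrite lt_neqAle eq_sym f0 fnorm_ge0.
have ip : 0 <= (fnorm f)^-1 by rewrite invr_ge0 ltW.
rewrite -ler_pdivrMr// mulrC -[X in X * _]ger0_norm//.
rewrite -fnormZ -(lro_homog hQ)//.
have S1 : [set g : L | fnorm g = 1] ((fnorm f)^-1 *: f).
  by rewrite /= fnormZ ger0_norm// mulVf.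
apply: sup_upper_bound; last by exists ((fnorm f)^-1 *: f).
split; last exact: rate_fnorm_bounded.
by exists (fnorm (Q ((fnorm f)^-1 *: f))), ((fnorm f)^-1 *: f).
Qed.

Lemma opnorm_ge0 : 0 <= opnorm Q.
Proof.
have /card_gt0P[x _] := X0.
pose f : L := const_fun 1.
have f1 : fnorm f = 1.
  apply/eqP; rewrite eq_le; apply/andP; split.
    by apply/fnorm_leP; split=> // y; rewrite const_funE normr1.
  by rewrite (le_trans _ (le_fnorm f x))// const_funE normr1.
by have := rate_fnorm_le f; rewrite f1 mulr1; apply: le_trans (fnorm_ge0 _).
Qed.

Lemma rate_cnorm_le f : fnorm (Q f) <= opnorm Q * cnorm f.
Proof.
have [c fc] := cnorm_midpoint X0 f.
by rewrite -(rate_shift f c) (le_trans (rate_fnorm_le _))// ler_wpM2l ?opnorm_ge0.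
Qed.

(** By superadditivity [Q f - Q g] lies between [Q (f - g)] and [- Q (g - f)]. *)
Lemma rate_lipschitz f g : fnorm (Q f - Q g) <= opnorm Q * fnorm (f - g).
Proof.
apply/fnorm_leP; split=> [|x]; first by rewrite mulr_ge0 ?opnorm_ge0 ?fnorm_ge0.
have := rateB_ge f g x; have := rateB_le f g x.
have /andP[] := fnorm_bounds (Q (f - g)) x.
have /andP[] := fnorm_bounds (Q (g - f)) x.
have := rate_fnorm_le (f - g); have := rate_fnorm_le (g - f).
rewrite -(fnormN (g - f)) opprB ler_norml !pointE; lra.
Qed.

(** An indicator has [cnorm] at most 1/2; this factor is what allows Euler steps of length up to
    [2 / opnorm Q]. *)
Lemma indic_rate_ge x : - opnorm Q / 2 <= Q (indic_fun x) x.
Proof.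
have : fnorm (Q (indic_fun x)) <= opnorm Q / 2.
  rewrite (le_trans (rate_cnorm_le _))// ler_wpM2l ?opnorm_ge0//.
  have -> : 2^-1 = (1 - 0) / 2 :> R by lra.
  by apply: cnorm_le => // y; rewrite ffunE ler0n lern1 leq_b1.
by move=> N2; have /andP[+ _] := fnorm_bounds (Q (indic_fun x)) x; lra.
Qed.

(** Subtracting [c] makes [f] non-negative; the step then keeps at least the fraction
    [1 + d * Q (indic_fun x) x] of the value at [x], and this fraction is non-negative. *)
Lemma euler_ge d f c : 0 <= d -> d * opnorm Q <= 2 ->
  (forall x, c <= f x) -> forall x, c <= euler Q d f x.
Proof.
move=> d0 dN cf x; rewrite /euler !pointE -(rate_shift f c).
have /(rate_diag_ge (f - const_fun c) x) : forall z, 0 <= (f - const_fun c) z.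
  by move=> z; rewrite !pointE subr_ge0.
move=> /(ler_wpM2l d0); have := indic_rate_ge x => /(ler_wpM2l d0).
rewrite !pointE; have := cf x; nra.
Qed.

Lemma eulerB_ge d f g x : 0 <= d ->
  euler Q d (f - g) x <= euler Q d f x - euler Q d g x.
Proof.
by move=> d0; rewrite /euler !pointE; have /(ler_wpM2l d0) := rateB_ge f g x; lra.
Qed.

Lemma euler_le d f c : 0 <= d -> d * opnorm Q <= 2 ->
  (forall x, f x <= c) -> forall x, euler Q d f x <= c.
Proof.
move=> d0 dN fc x.
have e0 : euler Q d 0 = 0 by rewrite /euler rate0 scaler0 addr0.
have := eulerB_ge d 0 f x d0; rewrite sub0r e0 [in X in _ <= X]ffunE.
have /(euler_ge d (- f) (- c) d0 dN) : forall z, - c <= (- f) z.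
  by move=> z; rewrite pointE lerN2.
move=> /(_ x); lra.
Qed.

Lemma euler_cnorm_le d f : 0 <= d -> d * opnorm Q <= 2 ->
  cnorm (euler Q d f) <= cnorm f.
Proof.
move=> d0 dN; apply: cnorm_le => // x.
by rewrite euler_ge ?euler_le//; [exact: sup_ge|exact: inf_le].
Qed.

(** By superadditivity the difference of two steps dominates the step from [f - g], which stays
    above [- fnorm (f - g)]; exchanging the roles bounds the other side. *)
Lemma euler_nonexpansive d f g : 0 <= d -> d * opnorm Q <= 2 ->
  fnorm (euler Q d f - euler Q d g) <= fnorm (f - g).
Proof.
have ge h h' x : 0 <= d -> d * opnorm Q <= 2 ->
    - fnorm (h - h') <= euler Q d h x - euler Q d h' x.
  move=> d0 dN; apply: le_trans (eulerB_ge _ _ _ _ d0).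
  by apply: euler_ge => // z; have /andP[] := fnorm_bounds (h - h') z.
move=> d0 dN; apply/fnorm_leP; split=> [|x]; first exact: fnorm_ge0.
have := ge f g x d0 dN; have := ge g f x d0 dN.
by rewrite -fnormN opprB ler_norml !pointE; lra.
Qed.

Lemma iter_euler_cnorm_le d j f : 0 <= d -> d * opnorm Q <= 2 ->
  cnorm (iter j (euler Q d) f) <= cnorm f.
Proof.
move=> d0 dN; elim: j => //= j; apply: le_trans; exact: euler_cnorm_le.
Qed.

End RateOperators.

(** A mean value inequality without differentiability: the first hypothesis bounds the growth rate
    to the right, the second excludes upward jumps from the left. The proof follows the bound up to
    the supremum of the times until which it holds. *)
Lemma growth_le (R : realType) (phi : R -> R) (d K : R) : 0 <= d -> 0 <= K ->
  (forall s eta, 0 <= s < d -> 0 < eta ->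
    exists2 h0, 0 < h0 & forall h, 0 < h < h0 -> phi (s + h) <= phi s + h * (K + eta)) ->
  (forall s eta, 0 < s <= d -> 0 < eta ->
    exists2 h0, 0 < h0 & forall h, 0 < h < h0 -> phi s <= phi (s - h) + eta) ->
  phi d <= phi 0 + d * K.
Proof.
move=> d0 K0 right left.
suff Heta eta : 0 < eta -> phi d <= phi 0 + d * (K + eta).
  (* Dividing by [d + 1] rather than [d] covers [d = 0]. *)
  apply/ler_addgt0Pr => e e0; have d1 : 0 < d + 1 by lra.
  apply: (le_trans (Heta (e / (d + 1)) _)); first by rewrite divr_gt0.
  have : d * (e / (d + 1)) <= e.
    by rewrite mulrA ler_pdivrMr// mulrC ler_wpM2l//; lra.
  lra.
move=> eta0; pose P r := phi r <= phi 0 + r * (K + eta).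
pose A := [set s | 0 <= s <= d /\ forall r, 0 <= r <= s -> P r].
have A0 : A 0.
  split=> [|r]; first by rewrite lexx.
  by rewrite andbC -eq_le => /eqP ->; rewrite /P mul0r addr0.
have supA : has_sup A.
  by split; [exists 0|exists d => s [/andP[]]].
set sg := sup A.
have sg0 : 0 <= sg by exact: sup_upper_bound.
have sgd : sg <= d by apply: ge_sup; [exists 0|move=> s [/andP[]]].
have Plt r : 0 <= r -> r < sg -> P r.
  move=> r0 rsg; have [|s [_ sP] rs] := @sup_adherent _ A (sg - r) _ supA.
    by rewrite subr_gt0.
  by apply: sP; move: rs; rewrite -/sg r0/=; lra.
have Psg : P sg.
  have [sgE|sgN] := eqVneq sg 0.
    by rewrite sgE; case: A0 => _; apply; rewrite lexx.
  have sgp : 0 < sg by rewrite lt_neqAle eq_sym sgN.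
  apply/ler_addgt0Pr => e e0.
  have [|h0 hp hle] := left sg e _ e0; first by rewrite sgp.
  pose h := Num.min h0 sg / 2.
  have mp : 0 < Num.min h0 sg by rewrite lt_min hp.
  have [m1 m2] : Num.min h0 sg <= h0 /\ Num.min h0 sg <= sg.
    by rewrite !ge_min !lexx orbT.
  have h1 : 0 < h < h0 by rewrite /h; lra.
  have lePsg := hle _ h1.
  have : P (sg - h) by apply: Plt; rewrite /h; lra.
  rewrite /P => lePh.
  have : 0 <= h * (K + eta) by rewrite mulr_ge0//; lra.
  lra.
have Asg : A sg.
  split=> [|r /andP[r0]]; first by rewrite sg0.
  by rewrite le_eqVlt => /predU1P[->//|]; apply: Plt.
have [sgE|sgN] := eqVneq sg d.
  by have := Psg; rewrite sgE.
have sgltd : sg < d by rewrite lt_neqAle sgN.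
have [|h0 hp hle] := right sg eta _ eta0; first by rewrite sg0.
have mp : 0 < Num.min h0 (d - sg) by rewrite lt_min hp subr_gt0.
have [m1 m2] : Num.min h0 (d - sg) <= h0 /\ Num.min h0 (d - sg) <= d - sg.
  by rewrite !ge_min !lexx orbT.
pose h := Num.min h0 (d - sg) / 2.
(* As [sg < d], the right hypothesis carries the bound on to [sg + h], contradicting the
   supremum. *)
suff : sg + h <= sg by rewrite /h; lra.
apply: sup_upper_bound => //; split=> [|r /andP[r0 rh]]; first by rewrite /h; lra.
have [rsg|sgr] := leP r sg; first by case: Asg => _; apply; rewrite r0.
have h1 : 0 < r - sg < h0 by rewrite /h in rh; lra.
by have := hle _ h1; have := Psg; rewrite subrKC /P; lra.
Qed.

(** * The error of Euler steps against a solution *)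

Section Solutions.
Context {R : realType} {X : finType} (X0 : (0 < #|X|)%N).
Local Notation L := {ffun X -> R}.
Context {Q : L -> L} (hQ : lower_rate_operator Q).

(** Multiplying the difference quotient by [|h|] gives a first-order expansion that also admits
    [h = 0]; [h] may have either sign. *)
Lemma solves_expansion (f : L) (u : R -> L) (s eta : R) :
  solves Q f u -> 0 <= s -> 0 < eta ->
  exists2 h0, 0 < h0 & forall h, `|h| < h0 -> 0 <= s + h ->
    fnorm (u (s + h) - u s - h *: Q (u s)) <= `|h| * eta.
Proof.
move=> [_ /(_ s) du] s0 eta0; have /cvgr0_norm_lt/(_ _ eta0) := du s0.
rewrite near_withinE => /nbhs_ballP[h0 /= hp hP]; exists h0 => // h hh0 sh.
have [->|hN] := eqVneq h 0.
  by rewrite addr0 subrr scale0r subr0 fnorm0 normr0 mul0r.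
have := hP h; rewrite /ball/= sub0r normrN => /(_ hh0 hN sh).
rewrite ger0_norm ?fnorm_ge0// => /ltW.
rewrite -(ler_pM2l (x := `|h|)) ?normr_gt0// -fnormZ scalerBr scalerA.
by rewrite divff// scale1r.
Qed.

Lemma fnorm_tri (a b c : L) : fnorm (a - c) <= fnorm (a - b) + fnorm (b - c).
Proof. by apply: le_trans (fnormD _ _); rewrite subrKA. Qed.

Lemma euler_step_error (f : L) (u : R -> L) (s d : R) (g : L) :
  solves Q f u -> 0 <= s -> 0 <= d ->
  fnorm (u (s + d) - euler Q d g)
    <= fnorm (u s - g) + d ^+ 2 * opnorm Q ^+ 2 * cnorm g.
Proof.
move=> du s0 d0; have N0 := opnorm_ge0 X0 hQ; have c0 := cnorm_ge0 X0 g.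
pose phi r := fnorm (u (s + r) - euler Q r g).
have phi0 : phi 0 = fnorm (u s - g) by rewrite /phi addr0 /euler scale0r addr0.
have -> : d ^+ 2 * opnorm Q ^+ 2 * cnorm g = d * (d * opnorm Q ^+ 2 * cnorm g).
  by ring.
rewrite -phi0; apply: growth_le => //.
- by rewrite mulr_ge0// mulr_ge0// exprn_ge0.
- move=> r eta /andP[r0 rd] eta0.
  have sr : 0 <= s + r by exact: addr_ge0.
  have [h0 hp hP] := solves_expansion _ _ _ _ du sr eta0.
  (* This makes [h * opnorm Q <= 2], so that the step is non-expansive; the [+ 1] covers
     [opnorm Q = 0]. *)
  exists (Num.min h0 (2 / (opnorm Q + 1))).
    by rewrite lt_min hp divr_gt0//; lra.
  move=> h /andP[h_gt0]; rewrite lt_min => /andP[hh0].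
  rewrite ltr_pdivlMr; last lra.
  move=> hN; have hge0 := ltW h_gt0.
  have hN2 : h * opnorm Q <= 2 by lra.
  (* The new distance splits into the expansion error of [u], the distance of two non-expansive
     steps, and the deviation of a fresh step at [v] from the straight line. *)
  pose v := euler Q r g.
  have e1 : fnorm (u (s + (r + h)) - euler Q h (u (s + r))) <= h * eta.
    have := hP h; rewrite ger0_norm// => /(_ hh0).
    by rewrite /euler opprD !addrA; apply; rewrite !addr_ge0.
  have e2 := euler_nonexpansive X0 hQ h (u (s + r)) v hge0 hN2.
  have e3 : fnorm (euler Q h v - euler Q (r + h) g)
      <= h * (d * opnorm Q ^+ 2 * cnorm g).
    have -> : euler Q h v - euler Q (r + h) g = h *: (Q v - Q g).
      by apply/ffunP => x; rewrite /v /euler !pointE; ring.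
    rewrite fnormZ ger0_norm// ler_wpM2l//.
    apply: le_trans (rate_lipschitz X0 hQ _ _) _.
    have -> : v - g = r *: Q g by rewrite /v /euler addrC addKr.
    rewrite fnormZ ger0_norm//.
    have -> : d * opnorm Q ^+ 2 * cnorm g = opnorm Q * (d * (opnorm Q * cnorm g)).
      by ring.
    by rewrite ler_wpM2l// ler_pM ?fnorm_ge0// ?(ltW rd)// rate_cnorm_le.
  have t1 := fnorm_tri (u (s + (r + h))) (euler Q h (u (s + r))) (euler Q (r + h) g).
  have t2 := fnorm_tri (euler Q h (u (s + r))) (euler Q h v) (euler Q (r + h) g).
  rewrite /phi (le_trans t1)// (le_trans (lerD e1 (le_trans t2 (lerD e2 e3))))//.
  by rewrite mulrDr addrCA (addrC (h * eta)).
- move=> r eta /andP[r0 rd] eta0.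
  have sr : 0 <= s + r by rewrite addr_ge0// ltW.
  have [h0 hp hP] := solves_expansion _ _ _ _ du sr ltr01.
  (* The speeds of [u] and of the line, plus 1 for the expansion error, bound the change of [phi]
     per unit of time. *)
  pose M := 1 + fnorm (Q (u (s + r))) + fnorm (Q g).
  have M0 : 0 < M by rewrite /M -addrA ltr_wpDr// addr_ge0 ?fnorm_ge0.
  exists (Num.min h0 (Num.min r (eta / M))).
    by rewrite !lt_min hp r0 divr_gt0.
  move=> h /andP[h_gt0]; rewrite !lt_min => /and3P[hh0 hr].
  rewrite ltr_pdivlMr// => hM; have hge0 := ltW h_gt0.
  have := hP (- h); rewrite normrN ger0_norm// -(addrA s) mulr1.
  move=> /(_ hh0 ltac:(lra)) e1.
  have e2 : fnorm (u (s + r) - u (s + (r - h))) <= h + h * fnorm (Q (u (s + r))).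
    rewrite -[X in _ + X * _](ger0_norm hge0) -fnormZ -(fnormN (h *: _)) -scaleNr.
    apply: le_trans (lerD e1 (lexx _)); rewrite -fnormN.
    by apply: le_trans (fnormD _ _); rewrite subrK opprB.
  have e3 : fnorm (euler Q (r - h) g - euler Q r g) = h * fnorm (Q g).
    have -> : euler Q (r - h) g - euler Q r g = - (h *: Q g).
      by apply/ffunP => x; rewrite /euler !pointE; ring.
    by rewrite fnormN fnormZ ger0_norm.
  have t1 := fnorm_tri (u (s + r)) (u (s + (r - h))) (euler Q r g).
  have t2 := fnorm_tri (u (s + (r - h))) (euler Q (r - h) g) (euler Q r g).
  rewrite /phi (le_trans t1)// addrC (le_trans (lerD t2 e2))// e3.
  by move: hM; rewrite /M; lra.
Qed.

(** The one-step bound starts from an arbitrary [g] and does not amplify the earlier error, so the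
    step errors merely add up. *)
Lemma euler_iter_error (f : L) (u : R -> L) (s d : R) (g : L) (k : nat) :
  solves Q f u -> 0 <= s -> 0 <= d ->
  fnorm (u (s + k%:R * d) - iter k (euler Q d) g)
    <= fnorm (u s - g) +
       d ^+ 2 * opnorm Q ^+ 2 * \sum_(0 <= j < k) cnorm (iter j (euler Q d) g).
Proof.
move=> du s0 d0; elim: k => [|k IH].
  by rewrite big_geq// mul0r mulr0 !addr0.
rewrite big_nat_recr//= mulrDr addrA -natr1 mulrDl mul1r addrA.
apply: le_trans (euler_step_error _ _ _ _ _ du _ d0) _; last by rewrite lerD2r.
by rewrite addr_ge0// mulr_ge0.
Qed.

(** The hypothesis forces [Q g = 0], so an Euler step does not move [g]. This serves the trivial
    cases and a loop ended early by a constant function. *)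
Lemma solves_stationary (f : L) (u : R -> L) (s d : R) (g : L) :
  solves Q f u -> 0 <= s -> 0 <= d -> opnorm Q * cnorm g = 0 ->
  fnorm (u (s + d) - g) <= fnorm (u s - g).
Proof.
move=> du s0 d0 Nc; have := euler_step_error _ _ _ _ g du s0 d0.
have Qg : Q g = 0.
  apply: fnorm_eq0; apply/eqP.
  by rewrite eq_le fnorm_ge0 andbT -Nc rate_cnorm_le.
by rewrite /euler Qg scaler0 addr0 expr2 -!mulrA Nc !mulr0 addr0.
Qed.

End Solutions.

(** * The adaptive procedure: step sizes, error budget, termination and iteration count *)

Section Procedure.
Context {R : realType} {X : finType} (X0 : (0 < #|X|)%N).
Local Notation L := {ffun X -> R}.
Context {Q : L -> L} (hQ : lower_rate_operator Q).
Context (f : L) (t eps : R) (m : nat).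
Local Notation N := (opnorm Q).
Local Notation state := (adaptive_state Q f t eps m).
Local Notation k_ := (adaptive_k Q f t eps m).
Local Notation delta := (adaptive_delta Q f t eps m).
Local Notation g_ := (adaptive_g Q f t eps m).

Lemma adaptive_kS i : k_ i.+1 = step_count Q t eps m (state i).1 (state i).2.
Proof. by rewrite /adaptive_k /=; case: (state i). Qed.

Lemma adaptive_deltaS i :
  delta i.+1 = step_length Q t eps m (state i).1 (state i).2.
Proof. by rewrite /adaptive_delta /=; case: (state i). Qed.

Lemma adaptive_timeS i :
  (state i.+1).1 = (state i).1 - (k_ i.+1)%:R * delta i.+1.
Proof. by rewrite adaptive_kS adaptive_deltaS /=; case: (state i). Qed.

Lemma adaptive_g_last i : g_ i m = (state i).2.
Proof. by case: i => //= i; rewrite adaptive_deltaS; case: (state i). Qed.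

Lemma adaptive_time_sum i :
  \sum_(1 <= l < i.+1) (k_ l)%:R * delta l = t - (state i).1.
Proof.
elim: i => [|i IH]; first by rewrite big_geq// subrr.
by rewrite big_nat_recr// IH adaptive_timeS opprB addrA addrAC.
Qed.

(** Starting from an arbitrary pass [i] makes the induction work; the list is non-empty because [k]
    applies to its last entry. *)
Lemma Phi_adaptive i n k :
  Phi Q m k [seq delta j | j <- iota i.+1 n.+1] (state i).2 = g_ (i + n.+1) k.
Proof.
elim: n i => [|n IH] i; first by rewrite addn1.
have -> : iota i.+1 n.+2 = i.+1 :: iota i.+2 n.+1 by [].
by rewrite map_cons addnS -addSn -IH -(adaptive_g_last i.+1).
Qed.

Context (t0 : 0 < t) (eps0 : 0 < eps) (m0 : (0 < m)%N).
Context (N0 : 0 < N) (f0 : 0 < cnorm f).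

Definition min_step := Num.min (2 / N) (eps / (t * N ^+ 2 * cnorm f)).
Local Notation dmin := min_step.

Let tN2_gt0 c : 0 < c -> 0 < t * N ^+ 2 * c.
Proof. by move=> c0; rewrite !mulr_gt0// exprn_gt0. Qed.

Lemma min_step_gt0 : 0 < dmin.
Proof. by rewrite /min_step lt_min !divr_gt0// tN2_gt0. Qed.

Lemma tentative_step_gt0 (D : R) (g : L) : 0 < D -> 0 < cnorm g ->
  0 < tentative_step Q t eps D g.
Proof. by move=> D0 c0; rewrite !lt_min D0 !divr_gt0// tN2_gt0. Qed.

(** If the remaining time does not attain the minimum, the other two bounds do, and the one with
    [cnorm g] only grows as [cnorm g] shrinks. *)
Lemma tentative_step_ge (D : R) (g : L) : 0 < cnorm g -> cnorm g <= cnorm f ->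
  tentative_step Q t eps D g < D -> dmin <= tentative_step Q t eps D g.
Proof.
move=> c0 cf; rewrite /tentative_step gt_min ltxx /= => mD.
rewrite (min_r (ltW mD)) /min_step le_min !ge_min lexx /=; apply/orP; right.
by rewrite ler_pM2l// lef_pV2 ?posrE ?tN2_gt0// ler_pM2l// mulr_gt0// exprn_gt0.
Qed.

(** Covers both branches of the step count at once. Of the last two clauses, one counts the steps of
    the final pass and the other describes a pass that leaves time over. *)
Variant pass_spec (D : R) (g : L) (k : nat) (d : R) : Prop :=
  PassSpec of (0 < k <= m)%N & 0 < d & d * N <= 2 &
    d * (t * N ^+ 2 * cnorm g) <= eps & k%:R * d <= D &
    k.-1%:R * dmin < D & (k%:R * d < D -> k = m /\ dmin <= d).

Lemma passP (D : R) (g : L) : 0 < D -> 0 < cnorm g -> cnorm g <= cnorm f ->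
  pass_spec D g (step_count Q t eps m D g) (step_length Q t eps m D g).
Proof.
move=> D0 c0 cf; rewrite /step_length /step_count.
set d := tentative_step Q t eps D g.
have d0 : 0 < d by exact: tentative_step_gt0.
have dN : d * N <= 2.
  by rewrite -ler_pdivlMr// /d /tentative_step !ge_min lexx orbT.
have deps : d * (t * N ^+ 2 * cnorm g) <= eps.
  by rewrite -ler_pdivlMr ?tN2_gt0// /d /tentative_step !ge_min lexx !orbT.
have dminP : d < D -> dmin <= d by exact: tentative_step_ge.
(* For [k = 1] the claim is [0 < D]; for larger [k], [d <= k.-1%:R * d < D] shows that the remaining
   time does not determine [d], so [dmin <= d]. *)
have preds k : (0 < k)%N -> k.-1%:R * d < D -> k.-1%:R * dmin < D.
  case: k => //= -[|k] _; first by rewrite !mul0r.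
  move=> kD; apply: le_lt_trans (kD); rewrite ler_wpM2l// dminP//.
  by apply: le_lt_trans kD; rewrite ler_peMl ?ler1n// ltW.
have [Dm|mD] := ltP D (m%:R * d).
  have Dd0 : 0 < D / d by rewrite divr_gt0.
  set k := `|Num.ceil (D / d)|%N.
  have kE : k%:Z = Num.ceil (D / d) by rewrite gez0_abs// ltW// ceil_gt0.
  have k0 : (0 < k)%N by rewrite -ltz_nat kE ceil_gt0.
  have kR : k%:R = (Num.ceil (D / d))%:~R :> R by rewrite -kE.
  have k0R : 0 < k%:R :> R by rewrite ltr0n.
  have km : (k <= m)%N by rewrite -lez_nat kE ceil_le_int ler_pdivrMr// ltW.
  have /andP[k1 k2] := ceil_itv (D / d).
  (* Rounding the count up only shortens the step, so the upper bounds on [d] survive. *)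
  have dk : D / k%:R <= d.
    by rewrite ler_pdivrMr// mulrC -ler_pdivrMr// kR.
  have kD : k%:R * (D / k%:R) = D by rewrite mulrC divfK// gt_eqF.
  split; rewrite ?k0 ?kD ?ltxx//.
  - by rewrite divr_gt0.
  - by apply: le_trans dN; rewrite ler_pM2r.
  - by apply: le_trans deps; rewrite ler_pM2r// tN2_gt0.
  - apply: preds => //; rewrite -ltr_pdivlMr//; apply: le_lt_trans k1.
    by rewrite -subn1 natrB// intrB kR.
have md : m.-1%:R * d < D.
  by apply: lt_le_trans mD; rewrite ltr_pM2r// ltr_nat prednK.
split; rewrite ?m0 ?leqnn//; first exact: preds.
move=> mD'; split=> //; apply: dminP; apply: le_lt_trans mD'.
by rewrite ler_peMl ?ler1n// ltW.
Qed.

Local Notation error i :=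
  (delta i ^+ 2 * N ^+ 2 * \sum_(0 <= j < k_ i) cnorm (g_ i j)).

Local Notation continues := (adaptive_continues Q f t eps m).

Lemma adaptive_passP i : continues i -> cnorm (state i).2 <= cnorm f ->
  pass_spec (state i).1 (state i).2 (k_ i.+1) (delta i.+1).
Proof.
rewrite /adaptive_continues adaptive_g_last adaptive_kS adaptive_deltaS.
by move=> [D0 c0] cf; exact: passP.
Qed.

(** The seminorm does not increase within a pass, and the choice of the step size then limits the
    pass to a share of [eps] proportional to the time it covers. *)
Lemma adaptive_error_le i : continues i -> cnorm (state i).2 <= cnorm f ->
  error i.+1 <= (k_ i.+1)%:R * delta i.+1 * (eps / t).
Proof.
move=> ci cf; have [_ d0 dN deps _ _ _] := adaptive_passP i ci cf.
have dge0 := ltW d0; set d := delta i.+1 in d0 dN deps dge0 *.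
have le_sum : \sum_(0 <= j < k_ i.+1) cnorm (g_ i.+1 j)
    <= (k_ i.+1)%:R * cnorm (state i).2.
  rewrite mulr_natl -[X in _ *+ X](subn0 (k_ i.+1)) -sumr_const_nat.
  by apply: ler_sum => j _; exact: iter_euler_cnorm_le.
apply: le_trans (ler_wpM2l _ le_sum) _; first by rewrite mulr_ge0 ?exprn_ge0// ltW.
rewrite mulrA ler_pdivlMr//.
have -> : d ^+ 2 * N ^+ 2 * ((k_ i.+1)%:R * cnorm (state i).2) * t =
    (k_ i.+1)%:R * d * (d * (t * N ^+ 2 * cnorm (state i).2)) by ring.
by rewrite ler_wpM2l// mulr_ge0.
Qed.

(** The count and error clauses ask for time left: a pass that exhausts the time may have fewer than
    [m] steps, while the state always performs [m]. *)
Lemma adaptive_invariant (u : R -> L) i : solves Q f u ->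
  (forall j, (j < i)%N -> continues j) ->
  [/\ 0 <= (state i).1 <= t, cnorm (state i).2 <= cnorm f &
      0 < (state i).1 ->
      [/\ (i * m)%:R * dmin <= t - (state i).1,
          forall j, (0 < j <= i)%N -> k_ j = m &
          fnorm (u (t - (state i).1) - (state i).2)
            <= \sum_(1 <= l < i.+1) error l]].
Proof.
move=> du; elim: i => [|i IH] ci.
  split; rewrite ?lexx ?(ltW t0)//= => _; split=> [||].
  - by rewrite subrr mul0n mul0r.
  - by case.
  - by rewrite big_geq// subrr; case: du => -> _; rewrite subrr fnorm0.
have [|/andP[D0 Dt] cf Dpos] := IH; first by move=> j ji; apply: ci; rewrite ltnS ltnW.
have ci1 := ci i (leqnn _); have [Dp _] := ci1.
have [im km err] := Dpos Dp.
have [/andP[k0 kle] d0 dN _ kD _ kmD] := adaptive_passP i ci1 cf.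
have dge0 := ltW d0.
have gS : (state i.+1).2 = iter m (euler Q (delta i.+1)) (state i).2.
  by rewrite -adaptive_g_last.
rewrite adaptive_timeS gS; split.
- by rewrite subr_ge0 kD/= (le_trans _ Dt)// gerBl mulr_ge0.
- by apply: le_trans cf; exact: iter_euler_cnorm_le.
- rewrite subr_gt0 => /kmD[kE dmd]; split.
  + rewrite kE mulSn natrD mulrDl.
    have : m%:R * dmin <= m%:R * delta i.+1 by rewrite ler_wpM2l.
    by move: im; lra.
  + move=> j /andP[j0]; rewrite leq_eqVlt => /predU1P[->//|ji].
    by apply: km; rewrite j0 -ltnS.
  + rewrite big_nat_recr//= kE opprB addrCA addrC.
    apply: le_trans (euler_iter_error X0 hQ _ _ _ _ _ _ du _ dge0) _.
      by rewrite subr_ge0.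
    by rewrite lerD2r.
Qed.

(** Each pass that leaves time over consumes at least [m%:R * dmin], so the loop condition fails at
    some index; the least such index is [n]. *)
Lemma adaptive_terminates (u : R -> L) : solves Q f u ->
  exists n, (forall i, (i < n)%N -> continues i) /\ ~ continues n.
Proof.
move=> du; have [n nc] : exists n, ~ continues n.
  apply/not_existsP => call; pose n := `|Num.ceil (t / dmin)|%N.
  have {}call i : continues i by apply: contrapT; exact: call.
  have [_ _ /(_ (call n).1)[nm _ _]] := adaptive_invariant u n du (fun j _ => call j).
  have Dp := (call n).1.
  have : t <= n%:R * dmin.
    rewrite -ler_pdivrMr ?min_step_gt0// (le_trans (ceil_ge _))//.
    rewrite -[n%:R]/(n%:Z%:~R) ler_int /n gez0_abs// ltW// ceil_gt0.
    by rewrite divr_gt0// min_step_gt0.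
  have : n%:R * dmin <= (n * m)%:R * dmin.
    by rewrite ler_pM2r ?min_step_gt0// ler_nat leq_pmulr.
  lra.
have ex : exists n, ~~ `[< continues n >] by exists n; apply/asboolPn.
case: (ex_minnP ex) => k /asboolPn nk kmin; exists k; split=> // i ik.
apply: contrapT => ni; have := kmin i; rewrite leqNgt ik => ki.
by have := ki (introT (asboolPn _) ni).
Qed.

(** The maximum inside the ceiling is [t / dmin]: dividing by a minimum gives the maximum of the
    quotients. *)
Lemma lt_ceil_iterations (p : nat) : p%:R * dmin < t ->
  p.+1%:Z <= Num.ceil (Num.max (N * t / 2) (t ^+ 2 * N ^+ 2 * cnorm f / eps)).
Proof.
move=> pt; set M := Num.max _ _.
suff pM : p%:R < M.
  have : (p%:Z)%:~R < (Num.ceil M)%:~R :> R by apply: lt_le_trans pM (ceil_ge _).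
  by rewrite ltr_int -lezD1 -PoszD addn1.
move: pt; rewrite /M lt_max /min_step minEle; case: ifP => _ pt; apply/orP; [left|right].
  by move: pt; rewrite mulrA ltr_pdivrMr// ltr_pdivlMr// mulrC; lra.
move: pt; rewrite mulrA ltr_pdivrMr ?tN2_gt0// ltr_pdivlMr//.
by congr (_ < _); ring.
Qed.

Lemma adaptive_estimate (u : R -> L) n : solves Q f u ->
  (forall i, (i < n)%N -> continues i) -> ~ continues n ->
  [/\ (1 <= n)%N, (1 <= k_ n <= m)%N,
      fnorm (u t - g_ n (k_ n)) <= \sum_(1 <= i < n.+1) error i &
      \sum_(1 <= i < n.+1) error i <= eps] /\
  (\sum_(1 <= i < n.+1) k_ i = (n - 1) * m + k_ n)%N /\
  ((n - 1) * m + k_ n)%N%:Z <=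
    Num.ceil (Num.max (N * t / 2) (t ^+ 2 * N ^+ 2 * cnorm f / eps)).
Proof.
case: n => [|n] du ci nc.
  by case: nc; split=> //=.
have ci' i : (i < n)%N -> continues i by move=> ilt; apply: ci; rewrite ltnS ltnW.
have cn := ci n (leqnn _); have [Dp _] := cn.
have [/andP[D0 Dt] cf /(_ Dp)[im km err]] := adaptive_invariant u n du ci'.
have [/andP[k0 kle] d0 dN _ kD kpred kmD] := adaptive_passP n cn cf.
have tD : 0 <= t - (state n).1 by rewrite subr_ge0.
have dge0 := ltW d0.
have errS : fnorm (u (t - (state n.+1).1) - g_ n.+1 (k_ n.+1))
    <= \sum_(1 <= i < n.+2) error i.
  rewrite big_nat_recr//= adaptive_timeS opprB addrCA addrC.
  apply: le_trans (euler_iter_error X0 hQ _ _ _ _ _ _ du tD dge0) _.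
  by rewrite lerD2r.
have [/andP[D0' Dt'] _ _] := adaptive_invariant u n.+1 du ci.
split; [split|split].
- by [].
- by rewrite k0.
(* Either the time is used up, or the loop stopped at a function with [cnorm] 0, whose distance to
   the solution does not grow over the remaining time. *)
- have [D1|] := eqVneq (state n.+1).1 0; first by rewrite D1 subr0 in errS.
  rewrite neq_lt ltNge D0'/= => Dp'.
  have kE : k_ n.+1 = m.
    by have [] := kmD; first by rewrite -subr_gt0 -adaptive_timeS.
  have g0 : cnorm (g_ n.+1 m) = 0.
    apply/eqP; rewrite eq_le cnorm_ge0// andbT leNgt; apply/negP => gp.
    by apply: nc; split.
  apply: le_trans errS; rewrite kE -{1}(subrK (state n.+1).1 t).
  apply: (solves_stationary X0 hQ _ _ _ _ _ du) => //; last by rewrite g0 mulr0.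
  by rewrite subr_ge0.
- have : \sum_(1 <= i < n.+2) error i
      <= \sum_(1 <= i < n.+2) (k_ i)%:R * delta i * (eps / t).
    apply: ler_sum_nat => -[//|i] /=; rewrite ltnS => iln.
    apply: adaptive_error_le; first exact: ci.
    have [|_ -> //] := adaptive_invariant u i du.
    by move=> j ji; apply: ci; apply: ltn_trans ji _.
  (* The passes together cover at most the time [t], so their shares sum to at most [eps]. *)
  move=> /le_trans; apply; rewrite -mulr_suml adaptive_time_sum mulrA.
  rewrite ler_pdivrMr// [leRHS]mulrC ler_pM2r//; lra.
- rewrite subn1 /= big_nat_recr//=; congr addn.
  rewrite (eq_big_nat _ _ (F2 := fun=> m)); first by rewrite sum_nat_const_nat subn1.
  by move=> i /andP[i0 iln]; apply: km; rewrite i0 -ltnS.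
(* All iterations but the very last, each counted with length [dmin], take strictly less than [t];
   the last one is the successor in the ceiling bound. *)
- rewrite subn1 /= -(prednK k0) addnS; apply: lt_ceil_iterations.
  by rewrite natrD mulrDl; move: im kpred; lra.
Qed.

End Procedure.

Theorem theorem6 (R : realType) (X : finType) (hX : (0 < #|X|)%N)
    (Q : {ffun X -> R} -> {ffun X -> R}) (hQ : lower_rate_operator Q)
    (T : R -> {ffun X -> R} -> {ffun X -> R}) (hT : lower_transition Q T)
    (f : {ffun X -> R}) (t eps : R) (m : nat)
    (ht : 0 <= t) (heps : 0 < eps) (hm : (0 < m)%N) :
  let k_ := adaptive_k Q f t eps m in
  let delta := adaptive_delta Q f t eps m in
  let g := adaptive_g Q f t eps m in
  (exists n k : nat, adaptive_output Q f t eps m n k) /\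
  forall n k : nat, adaptive_output Q f t eps m n k ->
    ([\/ cnorm f = 0, opnorm Q = 0 | t = 0] ->
       fnorm (T t f - g n k) = 0) /\
    (~ [\/ cnorm f = 0, opnorm Q = 0 | t = 0] ->
       let eps' := \sum_(1 <= i < n.+1)
         delta i ^+ 2 * opnorm Q ^+ 2 * \sum_(0 <= j < k_ i) cnorm (g i j) in
       [/\ (1 <= n)%N,
           (1 <= k <= m)%N,
           fnorm (T t f - Phi Q m k [seq delta i | i <- iota 1 n] f) =
             fnorm (T t f - g n k),
           fnorm (T t f - g n k) <= eps' &
           eps' <= eps] /\
       (\sum_(1 <= i < n.+1) k_ i = (n - 1) * m + k)%N /\
       ((n - 1) * m + k)%N%:Z <=
         Num.ceil (Num.max (opnorm Q * t / 2)
                           (t ^+ 2 * opnorm Q ^+ 2 * cnorm f / eps))).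
Proof.
move=> k_ delta g; have du := hT f.
have pos : ~ adaptive_trivial Q f t -> [/\ 0 < t, 0 < opnorm Q & 0 < cnorm f].
  move=> nt; rewrite !lt_neqAle ht opnorm_ge0// cnorm_ge0// !andbT ![0 == _]eq_sym.
  by split; apply/eqP => E0; apply: nt; [apply: Or33|apply: Or32|apply: Or31].
split.
  have [triv|nt] := pselect (adaptive_trivial Q f t); first by exists 0%N, m; left.
  have [t0 N0 f0] := pos nt.
  have [n [cn ncn]] := adaptive_terminates hX hQ f t eps m t0 heps hm N0 f0 _ du.
  by exists n, (k_ n); right.
move=> n k [[triv [-> ->]]|[nt [cn [ncn ->]]]]; split=> //.
  move=> _; apply/eqP; rewrite eq_le fnorm_ge0 andbT.
  have u0 : T 0 f = f by case: du.
  (* In the first two cases [f] is stationary, so the solution keeps its initial value; for [t = 0]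
     this is the initial condition. *)
  case: triv => [c0|N0|->]; last by rewrite u0 subrr fnorm0.
    have := solves_stationary hX hQ f _ 0 t f du (lexx _) ht.
    by rewrite c0 mulr0 add0r u0 subrr fnorm0; apply.
  have := solves_stationary hX hQ f _ 0 t f du (lexx _) ht.
  by rewrite N0 mul0r add0r u0 subrr fnorm0; apply.
move=> _ eps'; have [t0 N0 f0] := pos nt.
have [[n1 km err erre] cnt] :=
  adaptive_estimate hX hQ f t eps m t0 heps hm N0 f0 _ n du cn ncn.
split=> //; split=> //.
case: n n1 {cn ncn km err erre cnt eps'} => // n _.
by rewrite (Phi_adaptive f t eps m 0 n).
Qed.
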